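(* Let $p\ge 2$ be an integer, $\pi$ a $p$-adic permutation, and $G$ a $p$-adic system. Then there is a $p$-adic system $F$ such that $\pi=\pi_{F,G}$. The $p$-adic system $F$ is uniquely determined up to $\sim_p$.
   Context: $p\ge2$ is an integer, not necessarily prime. $\mathbb{Z}_p=\varprojlim \mathbb{Z}/p^k\mathbb{Z}$; every $a\in\mathbb{Z}_p$ is uniquely $a=\sum_{i\ge0}a_ip^i$ with $a_i\in\{0,\dots,p-1\}$, and $a\,\%\,p:=a_0$. A $p$-fibred function with domain $\mathbb{Z}_p$ is a $p$-tuple $F=(F[0],\dots,F[p-1])$ of functions $F[r]:\mathbb{Z}_p\to\mathbb{Z}_p$, regarded also as a function $F:\mathbb{Z}_p\to\mathbb{Z}_p$ by $F(n)=\dfrac{F[n\%p](n)-(F[n\%p](n)\,\%\,p)}{p}$. The $F$-digit expansion of $n$ is $\psi_F(n):=(F^k(n)\,\%\,p)_{k\ge0}$. $F$ is a $p$-adic system if for all integers $k\ge0$ and all $m,n\in\mathbb{Z}_p$: $m\equiv n\pmod{p^k}$ if and only if the first $k$ entries of $\psi_F(m)$ and $\psi_F(n)$ coincide. For a $p$-adic system $F$, the map $\psi_F$ is a bijection from $\mathbb{Z}_p$ onto the set of infinite sequences with entries in $\{0,\dots,p-1\}$. For $p$-adic systems $F,G$ put $\pi_{F,G}:=\psi_G^{-1}\circ\psi_F:\mathbb{Z}_p\to\mathbb{Z}_p$. $F\sim_p F'$ means that $F(n)=F'(n)$ for all $n\in\mathbb{Z}_p$ (equality as functions on $\mathbb{Z}_p$).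 A $p$-adic permutation is a permutation $\pi$ of $\mathbb{Z}_p$ such that $\pi(n)\equiv n\pmod p$ for all $n\in\mathbb{Z}_p$, and for all integers $k\ge1$ and all $m,n\in\mathbb{Z}_p$: $m\equiv n\pmod{p^k}\Leftrightarrow\pi(m)\equiv\pi(n)\pmod{p^k}$. *)

(* Defs.v *)
From HB Require Import structures.
From mathcomp Require Import all_boot all_order all_algebra.
From mathcomp Require Import boolp classical_sets functions.

Set Implicit Arguments.
Unset Strict Implicit.
Unset Printing Implicit Defensive.

Import Order.TTheory GRing.Theory Num.Theory.
Local Open Scope ring_scope.

(* The inverse limit of the rings Z/p^k: the residue class of a p-adic integer
   modulo p^k is given by its representative in [0, p^k), so that the coherence
   condition also forces [padic_proj x k] to be reduced. *)
Record padic (p : nat) : Type := Padic {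
  padic_proj :> nat -> int;
  padic_coh : forall k, padic_proj k = (padic_proj k.+1 %% (p ^ k)%N)%Z }.

HB.instance Definition _ (p : nat) := gen_eqMixin (padic p).
HB.instance Definition _ (p : nat) := gen_choiceMixin (padic p).

Lemma padicP (p : nat) (x y : padic p) : (forall k, x k = y k) -> x = y.
Proof.
case: x y => [x hx] [y hy] /= /funext exy; move: exy hx hy => -> hx hy.
by rewrite (Prop_irrelevance hx hy).
Qed.

Lemma padic_mod (p : nat) (x : padic p) (k : nat) : (x k %% (p ^ k)%N)%Z = x k.
Proof. by rewrite padic_coh modz_mod. Qed.

Lemma padic_cohm (p : nat) (x : padic p) (k : nat) :
  (x k.+1 = x k %[mod (p ^ k)%N])%Z.
Proof. by rewrite padic_mod -padic_coh. Qed.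

Lemma modz_dvdm (d e m : int) : (d %| e)%Z -> ((m %% e)%Z = m %[mod d])%Z.
Proof.
by case/dvdzP=> q ->; rewrite {2}(divz_eq m (q * d)) mulrA modzMDl.
Qed.

Lemma padic_of_subproof (p : nat) (f : nat -> int)
  (hf : forall k, (f k.+1 = f k %[mod (p ^ k)%N])%Z) (k : nat) :
  (f k %% (p ^ k)%N)%Z = ((f k.+1 %% (p ^ k.+1)%N)%Z %% (p ^ k)%N)%Z.
Proof. by rewrite modz_dvdm ?hf // dvdzE /= dvdn_exp2l. Qed.

Definition padic_of (p : nat) (f : nat -> int)
    (hf : forall k, (f k.+1 = f k %[mod (p ^ k)%N])%Z) : padic p :=
  Padic (padic_of_subproof hf).

Section PadicRing.
Variable p : nat.
Implicit Types x y z : padic p.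

Fact padic_const_subproof (c : int) (k : nat) : (c = c %[mod (p ^ k)%N])%Z.
Proof. by []. Qed.

Fact padic_opp_subproof x k : (- x k.+1 = - x k %[mod (p ^ k)%N])%Z.
Proof. by rewrite -modzNm padic_cohm modzNm. Qed.

Fact padic_add_subproof x y k :
  (x k.+1 + y k.+1 = x k + y k %[mod (p ^ k)%N])%Z.
Proof. by rewrite -modzDm !padic_cohm modzDm. Qed.

Fact padic_mul_subproof x y k :
  (x k.+1 * y k.+1 = x k * y k %[mod (p ^ k)%N])%Z.
Proof. by rewrite -modzMm !padic_cohm modzMm. Qed.

Definition padic_const c := padic_of (padic_const_subproof c).
Definition padic_opp x := padic_of (padic_opp_subproof x).
Definition padic_add x y := padic_of (padic_add_subproof x y).
Definition padic_mul x y := padic_of (padic_mul_subproof x y).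

Fact padic_addA : associative padic_add.
Proof. by move=> x y z; apply: padicP => k /=; rewrite modzDml modzDmr addrA. Qed.

Fact padic_addC : commutative padic_add.
Proof. by move=> x y; apply: padicP => k /=; rewrite addrC. Qed.

Fact padic_add0 : left_id (padic_const 0) padic_add.
Proof. by move=> x; apply: padicP => k /=; rewrite mod0z add0r padic_mod. Qed.

Fact padic_addN : left_inverse (padic_const 0) padic_opp padic_add.
Proof. by move=> x; apply: padicP => k /=; rewrite modzDml addNr. Qed.

HB.instance Definition _ :=
  GRing.isZmodule.Build (padic p) padic_addA padic_addC padic_add0 padic_addN.

Fact padic_mulA : associative padic_mul.
Proof. by move=> x y z; apply: padicP => k /=; rewrite modzMml modzMmr mulrA. Qed.

Fact padic_mulC : commutative padic_mul.
Proof. by move=> x y; apply: padicP => k /=; rewrite mulrC. Qed.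

Fact padic_mul1 : left_id (padic_const 1) padic_mul.
Proof. by move=> x; apply: padicP => k /=; rewrite modzMml mul1r padic_mod. Qed.

Fact padic_mulDl : left_distributive padic_mul padic_add.
Proof.
move=> x y z; apply: padicP => k /=.
by rewrite modzMml mulrDl modzDml modzDmr.
Qed.

HB.instance Definition _ := GRing.Zmodule_isComPzRing.Build (padic p)
  padic_mulA padic_mulC padic_mul1 padic_mulDl.

Lemma padic_projD x y k : (x + y) k = ((x k + y k) %% (p ^ k)%N)%Z.
Proof. by []. Qed.

Lemma padic_projN x k : (- x) k = ((- x k) %% (p ^ k)%N)%Z.
Proof. by []. Qed.

Lemma padic_projB x y k : (x - y) k = ((x k - y k) %% (p ^ k)%N)%Z.
Proof. by rewrite padic_projD padic_projN modzDmr. Qed.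

Lemma padic_projM x y k : (x * y) k = ((x k * y k) %% (p ^ k)%N)%Z.
Proof. by []. Qed.

Lemma padic_proj_nat n k : (n%:R : padic p) k = (n%:Z %% (p ^ k)%N)%Z.
Proof.
elim: n => [//|n IHn].
by rewrite -natr1 padic_projD IHn modzDm -addn1 PoszD.
Qed.

End PadicRing.

(* x % p, i.e. the digit of index 0 of x, is the residue of x modulo p^1. *)
Definition padic_digit (p : nat) (x : padic p) : nat := `|x 1%N|%N.

(* The projections of x are divided by p with a shift of index, x being
   determined modulo p^(k+1) when x / p is determined modulo p^k; if p does not
   divide x this is the quotient of x minus its first digit. *)
Fact padic_divp_subproof (p : nat) (x : padic p) (k : nat) :
  ((x k.+2 %/ p)%Z = (x k.+1 %/ p)%Z %[mod (p ^ k)%N])%Z.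
Proof.
have [p0|p0] := eqVneq p%:Z 0; first by rewrite p0 !divz0.
rewrite (padic_coh x k.+1) {1}(divz_eq (x k.+2) (p ^ k.+1)%N).
by rewrite expnSr PoszM mulrA divzMDl // modzMDl.
Qed.

Definition padic_divp (p : nat) (x : padic p) : padic p :=
  padic_of (padic_divp_subproof x).

Lemma padic_proj0 (p : nat) (x : padic p) : x 0%N = 0.
Proof. by rewrite padic_coh expn0 modz1. Qed.

Lemma padic_proj1 (p : nat) (hp : (1 < p)%N) (x : padic p) :
  x 1%N = padic_digit x.
Proof.
have p0 : p%:Z != 0 by rewrite -lt0n ltnW.
by rewrite /padic_digit gez0_abs // padic_coh modz_ge0 // expn1.
Qed.

Lemma padic_digit_lt (p : nat) (hp : (1 < p)%N) (x : padic p) :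
  (padic_digit x < p)%N.
Proof.
rewrite -ltz_nat -padic_proj1 // padic_coh expn1.
by rewrite ltz_pmod // ltz_nat ltnW.
Qed.

Lemma padic_proj_le (p : nat) (x : padic p) (j k : nat) : (j <= k)%N ->
  (x k %% (p ^ j)%N)%Z = x j.
Proof.
move=> /subnK <-; elim: (k - j)%N => [|i IHi]; first exact: padic_mod.
rewrite addSn -{}IHi [in RHS]padic_coh modz_dvdm //.
by rewrite dvdzE /= dvdn_exp2l // leq_addl.
Qed.

Lemma padic_divpK (p : nat) (hp : (1 < p)%N) (x : padic p) :
  p%:R * padic_divp x = x - (padic_digit x)%:R.
Proof.
apply: padicP => k.
rewrite padic_projB padic_projM !padic_proj_nat /= modzMm.
rewrite -padic_proj1 // -(@padic_proj_le p x 1 k.+1) // expn1.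
rewrite -[RHS]modzDmr modzNm modzDmr ?modzMmr.
have -> : p%:Z * (x k.+1 %/ p)%Z = x k.+1 - (x k.+1 %% p)%Z.
  by rewrite {2}(divz_eq (x k.+1) p) addrK mulrC.
by rewrite -modzDml padic_cohm modzDml.
Qed.

Lemma padic_mulpK (p : nat) (hp : (1 < p)%N) (x : padic p) :
  padic_divp (p%:R * x) = x.
Proof.
have p0 : p%:Z != 0 by rewrite -lt0n ltnW.
have pp : 0 < p%:Z by rewrite ltz_nat ltnW.
apply: padicP => k.
rewrite /= padic_proj_nat modzMml expnS PoszM -mulz_modr // mulKz //.
by rewrite modz_mod -padic_coh.
Qed.

Definition padic_congr (p k : nat) (x y : padic p) : Prop :=
  exists d : padic p, x - y = p%:R ^+ k * d.

Lemma padic_proj_eq0 (p : nat) (hp : (1 < p)%N) (k : nat) (z : padic p) :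
  z k = 0 -> exists d : padic p, z = p%:R ^+ k * d.
Proof.
elim: k z => [z _|k IHk z zk0]; first by exists z; rewrite expr0 mul1r.
have z10 : padic_digit z = 0%N.
  by rewrite /padic_digit -(@padic_proj_le p z 1 k.+1) // zk0 mod0z.
have [|d dE] := IHk (padic_divp z); first by rewrite /= zk0 div0z mod0z.
by exists d; rewrite exprS -mulrA -dE padic_divpK // z10 subr0.
Qed.

Lemma padic_congrP (p : nat) (hp : (1 < p)%N) (k : nat) (x y : padic p) :
  padic_congr k x y <-> x k = y k.
Proof.
split=> [[d dE]|xy]; last first.
  by apply: padic_proj_eq0; rewrite // padic_projB xy subrr mod0z.
rewrite -(subrK y x) dE padic_projD padic_projM -natrX padic_proj_nat modzz.
by rewrite mul0r mod0z add0r padic_mod.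
Qed.

Definition fibred (p : nat) : Type := p.-tuple (padic p -> padic p).

(* The default value of [nth] is never used when p >= 2, by [padic_digit_lt]. *)
Definition fibred_fun (p : nat) (F : fibred p) (n : padic p) : padic p :=
  let y := nth id F (padic_digit n) n in
  padic_divp (y - (padic_digit y)%:R).

Definition digit_expansion (p : nat) (F : fibred p) (n : padic p) : nat -> nat :=
  fun k => padic_digit (iter k (fibred_fun F) n).

Definition padic_system (p : nat) (F : fibred p) : Prop :=
  forall (k : nat) (m n : padic p),
    padic_congr k m n <->
    (forall i, (i < k)%N -> digit_expansion F m i = digit_expansion F n i).

(* For a p-adic system G, [digit_expansion G] is injective with range the set of
   all sequences with entries in {0, ..., p - 1}, and [pinv] is its inverse
   there. *)
Definition padic_pi (p : nat) (F G : fibred p) : padic p -> padic p :=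
  'pinv_(fun=> 0) [set: padic p] (digit_expansion G) \o digit_expansion F.

Definition fibred_eq (p : nat) (F F' : fibred p) : Prop :=
  fibred_fun F =1 fibred_fun F'.

Definition padic_permutation (p : nat) (f : padic p -> padic p) : Prop :=
  [/\ bijective f,
      forall n, padic_congr 1 (f n) n &
      forall (k : nat) (m n : padic p), (1 <= k)%N ->
        padic_congr k m n <-> padic_congr k (f m) (f n)].

(* Main.v *)
Require Import Defs.
From mathcomp Require Import all_boot.
From mathcomp Require Import ssralg ssrint intdiv.
From mathcomp Require Import boolp classical_sets functions.

(** The condition [pi = padic_pi F G] says that [digit_expansion F] equals
    [digit_expansion G \o pi]. It holds when [F], as a function on the p-adic
    integers, is the conjugate of [G] by [pi], because [pi] preserves the first
    digit; and [F] is a p-adic system because [pi] preserves congruences.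
    Conversely, since [digit_expansion G] is onto the sequences of digits, [pi]
    determines [digit_expansion F], whose injectivity determines [F n] from its
    expansion, the shift of that of [n]. *)

Set Implicit Arguments.
Unset Strict Implicit.
Unset Printing Implicit Defensive.

Import GRing.Theory.
Local Open Scope ring_scope.

Lemma padic_digit_mulp (p : nat) (x : padic p) :
  padic_digit (p%:R * x) = 0%N.
Proof.
by rewrite /padic_digit padic_projM padic_proj_nat expn1 modzz mul0r mod0z.
Qed.

Lemma padic_congr0 (p : nat) (hp : (1 < p)%N) (x y : padic p) :
  padic_congr 0 x y.
Proof. by apply/(padic_congrP hp); rewrite !padic_proj0. Qed.

(** All components can be [p%:R * f n]: its digit of index 0 vanishes, so dividing by [p] gives
    [f n] back. A fibred tuple can thus be prescribed through its function. *)
Lemma fibred_fun_onto (p : nat) (hp : (1 < p)%N) (f : padic p -> padic p) :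
  exists F : fibred p, fibred_fun F =1 f.
Proof.
exists (nseq_tuple p (fun n => p%:R * f n)) => n.
rewrite /fibred_fun nth_nseq padic_digit_lt // padic_digit_mulp subr0.
exact: padic_mulpK.
Qed.

Lemma digit_expansion_lt (p : nat) (hp : (1 < p)%N) (F : fibred p)
    (n : padic p) (i : nat) :
  (digit_expansion F n i < p)%N.
Proof. exact: padic_digit_lt. Qed.

Lemma digit_expansion_fibred_fun (p : nat) (F : fibred p) (n : padic p)
    (i : nat) :
  digit_expansion F (fibred_fun F n) i = digit_expansion F n i.+1.
Proof. by rewrite /digit_expansion iterSr. Qed.

Lemma digit_expansion_inj (p : nat) (hp : (1 < p)%N) (F : fibred p) :
  padic_system F -> injective (digit_expansion F).
Proof.
move=> hF m n mn; apply: padicP => k.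
by apply/(padic_congrP hp)/hF => i _; rewrite mn.
Qed.

(* The first k digits inject the p^k residue classes modulo p^k into the p^k
   words of length k. *)
Lemma digit_expansion_prefix (p : nat) (hp : (1 < p)%N) (F : fibred p)
    (hF : padic_system F) (s : nat -> nat) (hs : forall i, (s i < p)%N)
    (k : nat) :
  exists n : padic p, forall i, (i < k)%N -> digit_expansion F n i = s i.
Proof.
pose d (a : 'I_(p ^ k)) : {ffun 'I_k -> 'I_p} :=
  [ffun i : 'I_k => Ordinal (digit_expansion_lt hp F (nat_of_ord a)%:R i)].
have d_inj : injective d.
  move=> a b /ffunP dab; apply: val_inj.
  have /(padic_congrP hp) : padic_congr k (nat_of_ord a)%:R ((nat_of_ord b)%:R : padic p).
    by apply/hF => i ik; move: (dab (Ordinal ik)); rewrite !ffunE => -[].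
  by rewrite !padic_proj_nat !modz_nat !modn_small ?ltn_ord // => -[].
have [|a da] := codomP (inj_card_onto d_inj _ [ffun i : 'I_k => Ordinal (hs i)]).
  by rewrite card_ffun !card_ord.
exists (nat_of_ord a)%:R => i ik.
by move/ffunP/(_ (Ordinal ik)): da; rewrite !ffunE => -[].
Qed.

Lemma digit_expansion_onto (p : nat) (hp : (1 < p)%N) (F : fibred p)
    (hF : padic_system F) (s : nat -> nat) (hs : forall i, (s i < p)%N) :
  exists n : padic p, digit_expansion F n = s.
Proof.
have [u hu] := choice (digit_expansion_prefix hp hF hs).
(* [u k.+1] and [u k] share their first [k] digits, so they agree modulo [p ^ k] and the diagonal
   [u k k] defines a limit. *)
have u_coh k : (u k.+1 k.+1 = u k k %[mod (p ^ k)%N])%Z.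
  rewrite -padic_coh padic_mod; apply/(padic_congrP hp)/hF => i ik.
  by rewrite !hu // leqW.
exists (padic_of u_coh); apply: funext => i.
(* Digit [i] depends on the residue modulo [p ^ i.+1], where the limit agrees with [u i.+1]. *)
rewrite -(hu i.+1) //; move: i (ltnSn i) => i.
by apply: (hF i.+1 _ _).1; apply/(padic_congrP hp); rewrite /= padic_mod.
Qed.

Lemma padic_piE (p : nat) (hp : (1 < p)%N) (F G : fibred p)
    (hG : padic_system G) (f : padic p -> padic p) :
  f = padic_pi F G <->
  forall n, digit_expansion F n = digit_expansion G (f n).
Proof.
have G_inj := digit_expansion_inj hp hG.
have pinvG : cancel (digit_expansion G)
    ('pinv_(fun=> 0) [set: padic p] (digit_expansion G)).
  by move=> n; apply: pinvKV; rewrite ?inE // => x y _ _; exact: G_inj.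
split=> [-> n|fE]; last by apply: funext => n; rewrite /padic_pi /= fE pinvG.
(* The partial inverse is the default 0 off the range of [digit_expansion G], so the expansion of
   [n] has to be placed in that range. *)
have [m mE] := digit_expansion_onto hp hG (digit_expansion_lt hp F n).
by rewrite /padic_pi /= -mE pinvG.
Qed.

(** By induction [f] carries the orbit of [n] under [F] to that of [f n] under [G], keeping the
    first digit of each term. *)
Lemma digit_expansion_conj (p : nat) (hp : (1 < p)%N) (F G : fibred p)
    (f : padic p -> padic p) (hf : forall n, padic_congr 1 (f n) n)
    (hFG : forall n, f (fibred_fun F n) = fibred_fun G (f n)) (n : padic p) :
  digit_expansion F n = digit_expansion G (f n).
Proof.
apply: funext => i; rewrite /digit_expansion.
have -> : iter i (fibred_fun G) (f n) = f (iter i (fibred_fun F) n).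
  by elim: i => //= i ->; rewrite hFG.
by rewrite /padic_digit ((padic_congrP hp _ _ _).1 (hf _)).
Qed.

Theorem theorem3p18 (p : nat) (hp : (2 <= p)%N) (pi : padic p -> padic p)
    (G : fibred p) (hpi : padic_permutation pi) (hG : padic_system G) :
  exists F : fibred p,
    [/\ padic_system F,
        pi = padic_pi F G &
        forall F' : fibred p,
          padic_system F' -> pi = padic_pi F' G -> fibred_eq F F'].
Proof.
have [[pi' piK pi'K] pi1 pi_congr] := hpi.
have [F FE] := fibred_fun_onto hp (fun n => pi' (fibred_fun G (pi n))).
have psiF n : digit_expansion F n = digit_expansion G (pi n).
  by apply: digit_expansion_conj => // m; rewrite FE pi'K.
have hF : padic_system F.
  (* [pi_congr] starts at exponent 1; for exponent 0 both sides hold trivially. *)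
  case=> [|k] m n; first by split=> // _; exact: padic_congr0.
  by rewrite !psiF pi_congr.
exists F; split=> //; first exact/padic_piE.
move=> F' _ /(padic_piE hp _ hG) psiF' n.
(* [F] and [F'] have the same expansions, those of [G] after [pi], so [F n] and [F' n] both expand
   to the shift of the expansion of [n]. *)
apply: (digit_expansion_inj hp hF); apply: funext => i.
rewrite digit_expansion_fibred_fun [in RHS]psiF -psiF'.
by rewrite digit_expansion_fibred_fun psiF' psiF.
Qed.
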